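(* Let $p$ be a prime, and let $n\in\mathbb N$ and $r\in\mathbb Z$. Set $n_0=\{n\}_p$ and $n_1=\{n_0-n\}_{p-1}=\{-\lfloor n/p\rfloor\}_{p-1}$. If $n_0\le n_1$, then $$F_p(n,r)\equiv\frac{(-1)^{n_1}}{n_1!}\sum_{k=0}^{n_0}\binom{n_0}{k}(-1)^k(k-r)^{n_1}\pmod p.$$ If $n_0>n_1=0$, then $$F_p(n,r)\equiv(-1)^{\{r\}_p}\binom{n_0}{\{r\}_p}\pmod p.$$ If $n_0>n_1>0$, then $$F_p(n,r)\equiv\frac{(-1)^{n_1-1}}{(n_1-1)!}\sum_{k=0}^{n_0}\binom{n_0}{k}(-1)^{k}(k-r)^{n_1}q_p(k-r)\pmod p.$$
   Context: $\mathbb N=\{0,1,2,\ldots\}$. For $a\in\mathbb Z$ and a positive integer $m$, $\{a\}_m$ denotes the least nonnegative residue of $a$ modulo $m$. For a prime $p$ and $a\in\mathbb Z$, $q_p(a)=(a^{p-1}-1)/p$ (a rational number, which is an integer when $p\nmid a$). For $n\in\mathbb N$ and $r\in\mathbb Z$, put $C_p(n,r)=\sum_{0\le k\le n,\ k\equiv r\,(\mathrm{mod}\ p)}\binom nk(-1)^k$. The Fleck quotient is $$F_p(n,r)=(-p)^{-\lfloor(n-1)/(p-1)\rfloor}C_p(n,r)+[\![n=0]\!],$$ where $[\![A]\!]$ is $1$ if the assertion $A$ holds and $0$ otherwise; it is an integer (Fleck). Convention: $0^0=1$. Congruences modulo $p$ between rational numbers are understood in the ring $\mathbb Z_p$ of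 $p$-adic integers, i.e. $x\equiv y\pmod p$ means $x-y\in p\mathbb Z_p$. *)

(* Defs.v *)
From mathcomp Require Import all_boot all_order all_algebra.

Set Implicit Arguments.
Unset Strict Implicit.
Unset Printing Implicit Defensive.

Import Order.TTheory GRing.Theory Num.Theory.
Local Open Scope ring_scope.

(* {a}_m, meaningful for m > 0 ([modz] is then nonnegative) *)
Definition residue (a : int) (m : nat) : nat := `|(a %% m%:Z)%Z|%N.

(* When p divides a this is not an integer, and the product
   a^m * q_p(a), m > 0, need not vanish modulo p. *)
Definition fermat_quotient (p : nat) (a : int) : rat :=
  (a%:~R ^+ p.-1 - 1) / p%:R.

Definition fleck_sum (p n : nat) (r : int) : int :=
  \sum_(0 <= k < n.+1 | (k%:Z == r %[mod p%:Z])%Z) 'C(n, k)%:Z * (-1) ^+ k.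

(* The exponent is an integer and the division is [divz], which is the floor for
   a positive divisor; for n = 0 the floor is -1. *)
Definition fleck_quotient (p n : nat) (r : int) : rat :=
  (- p%:R) ^ (- ((n%:Z - 1) %/ (p%:Z - 1))%Z) * (fleck_sum p n r)%:~R
  + (n == 0%N)%:R.

(* For prime p, a rational number belongs to the ring of p-adic integers iff p
   does not divide its reduced denominator. *)
Definition padic_integral (p : nat) (x : rat) : Prop :=
  ~~ (p%:Z %| denq x)%Z.

Definition rat_congr (p : nat) (x y : rat) : Prop :=
  exists2 z : rat, padic_integral p z & x - y = p%:R * z.

(* Main.v *)
(* Work in Z[X]/(X^p - 1), where the coefficient of X^r in (1 - X)^n is C_p(n,r).
   With y = 1 - X one has y^(p-1) = (1 + X + ... + X^(p-1)) - p U, hence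
   y^p = -p y U.  So for n = (p-1) a + e with 1 <= e <= p-1, the Fleck quotient
   F_p(n,r) is the coefficient of X^r in y^e U^a, and modulo p only a mod p
   matters because U^p = 1.  As a = e - n0 mod p, this is formally
   y^n0 T^(e - n0) with T = y U, which plays the role of -log X modulo p: the
   derivation X d/dX sends T to -1 (up to the norm element), which determines
   the coefficients of the powers of T.  This settles e > n0 (that is, n0 <= n1)
   and e = n0 (that is, n1 = 0).  If e < n0, the exponent is -n1 and one has to
   divide y^n0 T^(p-1-n1) by -p, so T is needed modulo p^2.  There T may be
   replaced by a Gauss sum of the Teichmueller character w(j) = j^p; its powers
   have coefficients proportional to w(r)^n1, and subtracting the polynomial
   r^n1, which the n0-th difference kills, produces the Fermat quotients. *)

Require Import Defs.
From mathcomp Require Import all_boot all_order all_algebra.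
From mathcomp Require Import finfield ring zify.

Import Order.TTheory GRing.Theory Num.Theory.
Import Pdiv.CommonRing Pdiv.RingMonic.
Local Open Scope ring_scope.

(** * Arithmetic in Z[X]/(X^p - 1) *)

(** Elements of Z[X]/(X^p - 1) are kept as polynomials, so that derivatives, substitutions and
    values at 1 stay available. *)
Definition cyc_coef (p : nat) (r : int) (P : {poly int}) : int :=
  (rmodp P ('X^p - 1))`_(residue r p).

(* For M = 0 this is congruence modulo X^p - 1 alone. *)
Definition pcong (p M : nat) (P Q : {poly int}) : Prop :=
  exists A B, P = Q + M%:R * A + ('X^p - 1) * B.

Lemma monic_Xn_sub1 (p : nat) : (0 < p)%N -> ('X^p - 1 : {poly int}) \is monic.
Proof. by move=> p_gt0; rewrite -polyC1 monicXnsubC. Qed.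

Lemma pcong_refl p M P : pcong p M P P.
Proof. by exists 0, 0; ring. Qed.

Lemma pcong_sym p M P Q : pcong p M P Q -> pcong p M Q P.
Proof. by case=> A [B ->]; exists (- A), (- B); ring. Qed.

Lemma pcong_trans p M P Q S : pcong p M P Q -> pcong p M Q S -> pcong p M P S.
Proof.
by case=> A [B ->] [A' [B' ->]]; exists (A + A'), (B + B'); ring.
Qed.

Lemma pcongM p M P Q P' Q' :
  pcong p M P Q -> pcong p M P' Q' -> pcong p M (P * P') (Q * Q').
Proof.
move=> [A [B ->]] [A' [B' ->]].
exists (A * Q' + A' * Q + M%:R * A * A' + A * ('X^p - 1) * B').
by exists (B * Q' + B' * Q + ('X^p - 1) * B * B' + M%:R * A' * B); ring.
Qed.

Lemma pcongMl p M S P Q : pcong p M P Q -> pcong p M (S * P) (S * Q).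
Proof. exact/pcongM/pcong_refl. Qed.

Lemma pcongX p M P Q n : pcong p M P Q -> pcong p M (P ^+ n) (Q ^+ n).
Proof.
move=> PQ; elim: n => [|n IHn]; first exact: pcong_refl.
by rewrite !exprS; apply: pcongM.
Qed.

Lemma pcong0_weaken p M P Q : pcong p 0 P Q -> pcong p M P Q.
Proof. by case=> A [B ->]; exists 0, B; ring. Qed.

(** Reduces coefficient identities that are additive in the polynomial to monomials. *)
Lemma poly_ind_Xn (K : {poly int} -> Prop) :
    (forall P Q, K P -> K Q -> K (P + Q)) -> (forall c i, K (c *: 'X^i)) ->
  forall P, K P.
Proof.
move=> KD KX P; rewrite -[P]coefK poly_def.
apply: big_ind => [|Q S|i _]; [|exact: KD|exact: KX].
by rewrite -(scale0r 'X^0); apply: KX.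
Qed.

Section CycCoef.

Variable p : nat.
Hypothesis p_gt0 : (0 < p)%N.

Let monD := monic_Xn_sub1 p p_gt0.

Lemma cyc_coefD r P Q : cyc_coef p r (P + Q) = cyc_coef p r P + cyc_coef p r Q.
Proof. by rewrite /cyc_coef rmodpD // coefD. Qed.

Lemma cyc_coefN r P : cyc_coef p r (- P) = - cyc_coef p r P.
Proof. by rewrite /cyc_coef rmodpN // coefN. Qed.

Lemma cyc_coefZ r c P : cyc_coef p r (c *: P) = c * cyc_coef p r P.
Proof. by rewrite /cyc_coef rmodpZ // coefZ. Qed.

Lemma cyc_coef0 r : cyc_coef p r 0 = 0.
Proof. by rewrite -(scale0r 0) cyc_coefZ mul0r. Qed.

Lemma cyc_coef_sum r I (s : seq I) (c : pred I) (F : I -> {poly int}) :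
  cyc_coef p r (\sum_(i <- s | c i) F i) = \sum_(i <- s | c i) cyc_coef p r (F i).
Proof. exact: (big_morph _ (cyc_coefD r) (cyc_coef0 r)). Qed.

Lemma cyc_coef_mod r P : cyc_coef p r (P * ('X^p - 1)) = 0.
Proof. by rewrite /cyc_coef rmodp_mull // coef0. Qed.

Lemma residueE (r : int) : (residue r p)%:Z = (r %% p%:Z)%Z.
Proof. by rewrite /residue gez0_abs // modz_ge0 //; lia. Qed.

Lemma residue_lt (r : int) : (residue r p < p)%N.
Proof. by rewrite -ltz_nat residueE ltz_pmod. Qed.

Lemma cyc_coef_small r (P : {poly int}) : (size P <= p)%N ->
  cyc_coef p r P = P`_(residue r p).
Proof.
move=> szP; rewrite /cyc_coef rmodp_small // -polyC1 size_XnsubC //.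
Qed.

Lemma cyc_coef_eqmod r s P : (r = s %[mod p%:Z])%Z -> cyc_coef p r P = cyc_coef p s P.
Proof. by rewrite /cyc_coef /residue => ->. Qed.

Lemma cyc_coefXn r i : cyc_coef p r 'X^i = (i%:Z == r %[mod p%:Z])%Z%:R.
Proof.
have [A ->] : exists A : {poly int}, 'X^i = 'X^(i %% p) + A * ('X^p - 1).
  (* Geometric sum for [('X^p) ^+ (i %/ p) - 1], multiplied by ['X^(i %% p)]. *)
  exists ('X^(i %% p) * \sum_(k < i %/ p) ('X^p) ^+ k).
  rewrite -mulrA [_ * ('X^p - 1)]mulrC -subrX1 mulrBr mulr1 -exprM -exprD.
  by rewrite subrKC addnC mulnC -divn_eq.
rewrite cyc_coefD cyc_coef_mod addr0 cyc_coef_small ?coefXn ?size_polyXn ?ltn_pmod //.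
by rewrite -eqz_nat residueE modz_nat eq_sym.
Qed.

Lemma cyc_coefXM r i P : cyc_coef p r ('X^i * P) = cyc_coef p (r - i%:Z) P.
Proof.
elim/poly_ind_Xn: P => [P Q hP hQ|c j]; first by rewrite mulrDr !cyc_coefD hP hQ.
rewrite -scalerAr -exprD !cyc_coefZ !cyc_coefXn !eqz_mod_dvd; congr (_ * (dvdz _ _)%:R).
by rewrite PoszD; ring.
Qed.

(** X d/dX multiplies X^i by i, and i = r modulo p for every exponent that contributes to the
    coefficient of index r. *)
Lemma cyc_coef_deriv r P :
  (p%:Z %| cyc_coef p r ('X * P^`()) - r * cyc_coef p r P)%Z.
Proof.
elim/poly_ind_Xn: P => [P Q hP hQ|c i].
  rewrite derivD mulrDr !cyc_coefD mulrDr.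
  by rewrite opprD addrACA rpredD.
rewrite derivZ derivXn -scalerAr !cyc_coefZ.
case: i => [|i]; last rewrite mulrnAr -exprS -scaler_nat cyc_coefZ.
  rewrite mulr0n mulr0 cyc_coef0 mulr0 sub0r rpredN cyc_coefXn.
  case: eqP => [|_]; last by rewrite !mulr0 dvdz0.
  rewrite mod0z => /esym /dvdz_mod0P ?; exact: dvdz_mulr.
rewrite cyc_coefXn; case: eqP => [/eqP|_]; last by rewrite !mulr0 subr0 dvdz0.
rewrite eqz_mod_dvd !mulr1 natz => h.
by rewrite [r * c]mulrC -mulrBr dvdz_mull.
Qed.

(** For a prime to p, X -> X^a permutes the exponents modulo p; this is the Galois action used on
    the Gauss sum. *)
Lemma cyc_coef_comp_Xn a r P : coprime a p ->
  cyc_coef p (a%:Z * r) (P \Po 'X^a) = cyc_coef p r P.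
Proof.
move=> cop; elim/poly_ind_Xn: P => [P Q hP hQ|c i].
  by rewrite comp_polyD !cyc_coefD hP hQ.
rewrite comp_polyZ comp_Xn_poly !cyc_coefZ -exprM !cyc_coefXn.
by rewrite !eqz_mod_dvd PoszM -mulrBr Gauss_dvdzr // coprimezE /= coprime_sym.
Qed.

Lemma pcong_cyc_coef r M P Q : pcong p M P Q ->
  (M%:Z %| cyc_coef p r P - cyc_coef p r Q)%Z.
Proof.
move=> [A [B ->]]; rewrite [_ * B]mulrC !cyc_coefD cyc_coef_mod addr0 addrC addKr.
by rewrite mulr_natl -scaler_nat cyc_coefZ dvdz_mulr // natz.
Qed.

Lemma cyc_coef_pcong M P Q :
  (forall r, (M%:Z %| cyc_coef p r P - cyc_coef p r Q)%Z) -> pcong p M P Q.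
Proof.
move=> PQ; set S := P - Q.
(* Divide P - Q by X^p - 1: the quotient is one witness, the remainder divided coefficientwise by M
   the other. *)
exists (\poly_(i < p) ((rmodp S ('X^p - 1))`_i %/ M%:Z)%Z), (rdivp S ('X^p - 1)).
have def_P : P = S + Q by rewrite subrK.
rewrite {1}def_P {1}(rdivp_eq monD S).
set A := \poly_(i < p) _; suff -> : rmodp S ('X^p - 1) = M%:R * A by ring.
apply/polyP => i; rewrite mulr_natl -scaler_nat coefZ coef_poly natz.
have szS: (size (rmodp S ('X^p - 1)) <= p)%N.
  by rewrite -ltnS -(size_XnsubC (1 : int) p_gt0) polyC1 ltn_rmodp monic_neq0.
case: ltnP => ip; last by rewrite mulr0 nth_default // (leq_trans szS).
rewrite mulrC divzK //; have := PQ i%:Z.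
by rewrite -cyc_coefN -cyc_coefD /cyc_coef /residue modz_nat modn_small.
Qed.

End CycCoef.

(** * The unit U and the truncated logarithm T *)

(* In terms of y = 1 - X, [fleckU p] reduces modulo p to the truncation of
   -log(1 - y)/y. *)
Definition fleckU (p : nat) : {poly int} :=
  \poly_(i < p) ((1 - (-1) ^+ i * 'C(p.-1, i)%:Z) %/ p%:Z)%Z.

Definition fleckT (p : nat) : {poly int} := (1 - 'X) * fleckU p.

Definition normX (p : nat) : {poly int} := \sum_(i < p) 'X^i.

Lemma normXM p : (1 - 'X) * normX p = - ('X^p - 1).
Proof. by rewrite subrX1 -mulNr opprB. Qed.

(** Makes the division in [fleckU] exact: by Pascal's rule, consecutive binomials of row p - 1 add
    up to a multiple of p. *)
Lemma bin_pred_prime p i : prime p -> (i < p)%N ->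
  (p%:Z %| 1 - (-1) ^+ i * 'C(p.-1, i)%:Z)%Z.
Proof.
move=> p_pr; elim: i => [|i IHi] ltip.
  by rewrite bin0 mulr1 subrr dvdz0.
have := prime_dvd_bin (k := i.+1) p_pr ltip.
case: p p_pr ltip IHi => // p p_pr ltip IHi /=.
rewrite binS => dv; have {}dv: (p.+1%:Z %| 'C(p, i.+1)%:Z + 'C(p, i)%:Z)%Z by [].
have -> : 1 - (-1) ^+ i.+1 * 'C(p, i.+1)%:Z = (1 - (-1) ^+ i * 'C(p, i)%:Z)
   + (-1) ^+ i * ('C(p, i.+1)%:Z + 'C(p, i)%:Z) by rewrite exprS; ring.
by rewrite rpredD ?dvdz_mull // IHi // ltnW.
Qed.

Lemma exprD1_prime (R : comNzRingType) (p : nat) (z : R) : prime p ->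
  exists g, (1 + z) ^+ p = 1 + z ^+ p + p%:R * g.
Proof.
case: p => // p p_pr.
exists (\sum_(i < p) ('C(p.+1, i.+1) %/ p.+1)%:R * z ^+ i.+1).
rewrite exprDn big_ord_recl big_ord_recr /=.
rewrite bin0 binn subn0 expr1n subnn !expr0 mulr1 mul1r mulr1n mulr1n /bump /= add1n.
rewrite -addrA; congr (_ + _); rewrite addrC; congr (_ + _).
rewrite mulr_sumr; apply: eq_bigr => i _.
rewrite add1n expr1n mul1r mulrA -natrM mulnC divnK ?mulr_natl //.
by apply: prime_dvd_bin => //=; rewrite ltnS.
Qed.

Section FleckUnit.

Variable p : nat.
Hypothesis p_pr : prime p.
Let p_gt0 := prime_gt0 p_pr.

Local Notation y := (1 - 'X : {poly int}).
Local Notation D := ('X^p - 1 : {poly int}).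
Local Notation U := (fleckU p).
Local Notation T := (fleckT p).

Lemma sub1X_expE n : y ^+ n = \sum_(i < n.+1) ((-1) ^+ i * 'C(n, i)%:Z) *: 'X^i.
Proof.
rewrite exprBn; apply: eq_bigr => i _.
rewrite expr1n mulr1 -scaler_nat natz [_ * _%:Z]mulrC -scalerA; congr (_ *: _).
by rewrite -[in LHS]signr_odd -[in RHS]signr_odd mulr_sign scaler_sign.
Qed.

Lemma sub1X_exp_pred : y ^+ p.-1 = normX p - p%:R * U.
Proof.
rewrite sub1X_expE prednK // /normX /U poly_def mulr_sumr -sumrB.
apply: eq_bigr => i _; rewrite mulr_natl -scaler_nat scalerA natz [p%:Z * _]mulrC divzK.
  by rewrite scalerBl scale1r subKr.
exact: bin_pred_prime.
Qed.

Lemma sub1X_exp_prime : y ^+ p = - D - p%:R * T.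
Proof.
rewrite -[X in y ^+ X](prednK p_gt0) exprS sub1X_exp_pred mulrBr normXM.
by rewrite /fleckT; ring.
Qed.

(** At X = 1 the identity y^(p-1) = N - p U, N the norm element, reads 0 = p - p U(1). *)
Lemma fleckU_horner1 : U.[1] = 1.
Proof.
have p1 : p.-1 != 0%N by rewrite -lt0n -ltnS prednK // prime_gt1.
have := congr1 (horner^~ 1) sub1X_exp_pred.
rewrite /= /normX horner_exp hornerD hornerN hornerM horner_sum hornerD hornerN.
rewrite hornerX hornerC (eq_bigr (fun=> 1)) => [|i _]; last by rewrite hornerXn expr1n.
rewrite subrr sumr_const card_ord expr0n (negPf p1) -polyC_natr hornerC /=.
move/esym/subr0_eq/eqP; rewrite -subr_eq0 -[X in X - _]mulr1 -mulrBr mulf_eq0.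
by rewrite pnatr_eq0 -[_ == 0%N]negbK -lt0n p_gt0 subr_eq0 => /eqP.
Qed.

Lemma fleckU_sub1 : exists v, U = 1 + y * v.
Proof.
have /factor_theorem[q Uq] : root (U - 1) 1.
  by rewrite /root !hornerE fleckU_horner1 subrr.
by exists (- q); rewrite -[LHS](subrK 1) Uq polyC1; ring.
Qed.

(** Frobenius: U = 1 + y v gives U^p = 1 + y^p v^p modulo p, and y^p vanishes modulo p and X^p -
    1. *)
Lemma fleckUX_period k : pcong p p (U ^+ (p * k)) 1.
Proof.
have [v Uv] := fleckU_sub1; have [g] := exprD1_prime _ _ (y * v) p_pr.
rewrite -Uv exprMn sub1X_exp_prime => Up.
rewrite exprM -(expr1n _ k); apply: pcongX; rewrite Up.
by exists (g - T * v ^+ p), (- v ^+ p); ring.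
Qed.

Lemma fleckUX_eqmod a b : (a = b %[mod p])%N -> pcong p p (U ^+ a) (U ^+ b).
Proof.
suff red n : pcong p p (U ^+ n) (U ^+ (n %% p)).
  by move=> ab; apply: pcong_trans (red a) _; rewrite ab; apply/pcong_sym/red.
rewrite {1}(divn_eq n p) exprD -[X in pcong _ _ _ X]mul1r mulnC.
exact: pcongM (fleckUX_period _) (pcong_refl _ _ _).
Qed.

(** Iterates y^p = -p y U. At least one factor y must remain to kill the norm element, hence the
    exponent [e.+1]. *)
Lemma sub1X_exp_fleckU a e :
  pcong p 0 (y ^+ (p.-1 * a + e.+1)) ((- p%:R) ^+ a * (y ^+ e.+1 * U ^+ a)).
Proof.
elim: a => [|a IHa]; first by rewrite muln0 !expr0 mul1r mulr1; apply: pcong_refl.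
have step : pcong p 0 (y ^+ p.-1 * y ^+ e.+1) (- p%:R * U * y ^+ e.+1).
  rewrite !exprS mulrA -exprSr prednK // sub1X_exp_prime /fleckT.
  by exists 0, (- y ^+ e); ring.
rewrite mulnS -addnA exprD.
apply: pcong_trans (pcongMl _ _ (y ^+ p.-1) _ _ IHa) _.
have -> : y ^+ p.-1 * ((- p%:R) ^+ a * (y ^+ e.+1 * U ^+ a)) =
   ((- p%:R) ^+ a * U ^+ a) * (y ^+ p.-1 * y ^+ e.+1) by ring.
have -> : (- p%:R) ^+ a.+1 * (y ^+ e.+1 * U ^+ a.+1) =
   ((- p%:R) ^+ a * U ^+ a) * (- p%:R * U * y ^+ e.+1).
  by rewrite [_ ^+ a.+1]exprS [U ^+ a.+1]exprS; ring.
exact: pcongMl.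
Qed.

(** Obtained by differentiating y^p = -(X^p - 1) - p T and cancelling p in Z[X]. *)
Lemma fleckT_deriv : 'X * T^`() = 'X * y ^+ p.-1 - 1 - D.
Proof.
suff -> : T^`() = y ^+ p.-1 - 'X^(p.-1).
  rewrite mulrBr -exprS prednK //; ring.
have := congr1 (@deriv _) sub1X_exp_prime.
rewrite deriv_exp derivB derivC derivX derivB derivN derivB derivXn derivC.
rewrite mulr_natl derivMn -(mulr_natl 'X^(p.-1)) -(mulr_natl T^`()) => eT.
apply/(mulfI (_ : (p%:R : {poly int}) != 0)).
  by rewrite -polyC_natr polyC_eq0 pnatr_eq0 -lt0n.
have -> : p%:R * T^`() =
    - (p%:R * 'X^(p.-1) - 0) - (- (p%:R * 'X^(p.-1) - 0) - p%:R * T^`()) by ring.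
by rewrite -eT; ring.
Qed.

(** Start of the descent on powers of T: modulo p, T^(p-1) is N U^(p-1), and N U = N because U - 1
    is a multiple of y, which kills the norm element N. *)
Lemma cyc_coef_fleckTX_pred r : (p%:Z %| cyc_coef p r (T ^+ p.-1) - 1)%Z.
Proof.
have NU k : pcong p 0 (normX p * U ^+ k) (normX p).
  elim: k => [|k IHk]; first by rewrite mulr1; apply: pcong_refl.
  rewrite exprS mulrCA; apply: pcong_trans (pcongMl _ _ U _ _ IHk) _.
  have [v ->] := fleckU_sub1.
  have -> : (1 + y * v) * normX p = normX p + v * (y * normX p) by ring.
  by rewrite normXM; exists 0, (- v); ring.
have TN : pcong p p (T ^+ p.-1) (normX p).
  apply: pcong_trans (pcong0_weaken _ _ _ _ (NU p.-1)).
  rewrite /fleckT exprMn sub1X_exp_pred.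
  by exists (- U ^+ p.-1 * U), 0; ring.
suff <- : cyc_coef p r (normX p) = 1 by apply: pcong_cyc_coef.
have -> : normX p = \poly_(i < p) 1.
  by rewrite poly_def; apply: eq_bigr => i _; rewrite scale1r.
by rewrite cyc_coef_small ?size_poly // coef_poly residue_lt.
Qed.

(** Descending powers: X d/dX sends T^(e+2) to -(e+2) T^(e+1) modulo p, and multiplies the
    coefficient of index r by r. *)
Lemma cyc_coef_fleckTX i r : (i < p.-1)%N ->
  (p%:Z %| i`!%:Z * cyc_coef p r (T ^+ (p.-1 - i)) - r ^+ i)%Z.
Proof.
elim: i => [|i IHi] ltip.
  by rewrite fact0 mul1r expr0 subn0 cyc_coef_fleckTX_pred.
have {IHi} := IHi (ltnW ltip).
have [e def_e] : exists e, (p.-1 - i = e.+2)%N by exists (p.-1 - i).-2; lia.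
have -> : (p.-1 - i.+1 = e.+1)%N by lia.
rewrite def_e => IHi.
(* The norm part of X T' disappears once multiplied by a further T. *)
have yT : y ^+ p.-1 * T = (- D - p%:R * T) * U.
  by rewrite mulrA -exprSr prednK // sub1X_exp_prime.
have dT : pcong p p ('X * (T ^+ e.+2)^`()) ((- e.+2%:Z) *: T ^+ e.+1).
  have -> : 'X * (T ^+ e.+2)^`() = e.+2%:R * ('X * T^`()) * T ^+ e.+1.
    by rewrite deriv_exp -mulr_natl; ring.
  have -> : (- e.+2%:Z) *: T ^+ e.+1 = - (e.+2%:R * T ^+ e.+1).
    by rewrite scaleNr -natz scaler_nat mulr_natl.
  have -> : e.+2%:R * ('X * T^`()) * T ^+ e.+1 =
      e.+2%:R * 'X * T ^+ e * (y ^+ p.-1 * T) - (1 + D) * (e.+2%:R * T ^+ e.+1).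
    by rewrite fleckT_deriv exprS; ring.
  rewrite yT exprS; move: (T ^+ e) (e.+2%:R) => Te c.
  by exists (- c * 'X * Te * T * U), (- c * 'X * Te * U - c * (T * Te)); ring.
have := pcong_cyc_coef p p_gt0 r p _ _ dT; rewrite cyc_coefZ // => h1.
have h2 := cyc_coef_deriv p p_gt0 r (T ^+ e.+2).
set c := cyc_coef p r (T ^+ e.+2) in IHi h2; set d := cyc_coef p r (T ^+ e.+1) in h1 *.
set w := cyc_coef p r _ in h1 h2.
have -> : i.+1`!%:Z * d - r ^+ i.+1 =
    i`!%:Z * ((w - r * c) - (w - - e.+2%:Z * d)) + r * (i`!%:Z * c - r ^+ i)
    + p%:Z * (i`!%:Z * d).
  rewrite factS PoszM [r ^+ i.+1]exprS.
  (* This turns the factor -(e+2) into i + 1 modulo p, which builds up the factorial. *)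
  have -> : p%:Z = i.+1%:Z + e.+2%:Z by rewrite -PoszD; congr Posz; lia.
  ring.
apply: rpredD; last exact: dvdz_mulr.
by apply: rpredD; apply: dvdz_mull => //; apply: rpredB.
Qed.

End FleckUnit.

(** * From p-adic congruences to divisibility, and Fleck quotients as coefficients *)

Lemma rat_congr_frac (p : nat) (z w m : int) : prime p -> ~~ (p%:Z %| m)%Z ->
  (p%:Z %| m * z - w)%Z -> rat_congr p z%:~R (w%:~R / m%:~R).
Proof.
move=> p_pr p_m /dvdzP[q def_q].
have m0 : m != 0 by apply: contraNneq p_m => ->; rewrite dvdz0.
exists (q%:~R / m%:~R); last first.
  have := congr1 (fun x : int => x%:~R : rat) def_q.
  rewrite /= rmorphB !rmorphM /= => h.
  apply/(mulIf (_ : m%:~R != 0 :> rat)); first by rewrite intr_eq0.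
  rewrite mulrBl divfK ?intr_eq0 // -mulrA divfK ?intr_eq0 // [p%:R * _]mulrC.
  by rewrite -h [z%:~R * _]mulrC.
(* The reduced denominator of q/m divides m, hence is prime to p. *)
apply: contra p_m => /dvdz_trans; apply.
set x := q%:~R / m%:~R.
have /eqP := divq_num_den x; rewrite eqr_div ?intr_eq0 ?denq_eq0 //.
rewrite -!rmorphM eqr_int => /eqP e.
have : (denq x %| numq x * m)%Z by rewrite e dvdz_mull.
by rewrite Gauss_dvdzr // coprimezE coprime_sym; exact: coprime_num_den.
Qed.

Section Sums.

Variable p : nat.
Hypothesis p_pr : prime p.
Let p_gt0 := prime_gt0 p_pr.

Local Notation y := (1 - 'X : {poly int}).

(** Multiplication by X shifts coefficients, so y^n acts as an n-th difference; the sums over k in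
    the theorem come from here. *)
Lemma cyc_coef_sub1XM n r P : cyc_coef p r (y ^+ n * P) =
  \sum_(0 <= k < n.+1) 'C(n, k)%:Z * (-1) ^+ k * cyc_coef p (r - k%:Z) P.
Proof.
rewrite sub1X_expE mulr_suml cyc_coef_sum // big_mkord; apply: eq_bigr => k _.
by rewrite -scalerAl cyc_coefZ // cyc_coefXM // [(-1) ^+ _ * _]mulrC.
Qed.

Lemma fleck_sumE n r : fleck_sum p n r = cyc_coef p r (y ^+ n).
Proof.
rewrite -[y ^+ n]mulr1 cyc_coef_sub1XM /fleck_sum big_mkcond /=.
apply: eq_bigr => k _; rewrite -cyc_coefXM // mulr1 cyc_coefXn //.
by case: ifP; rewrite ?mulr1 ?mulr0.
Qed.

(** Here floor((n-1)/(p-1)) = a, so the power of -p cancels exactly the one extracted from y^n. *)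
Lemma fleck_quotientE a e r : (e < p.-1)%N ->
  fleck_quotient p (p.-1 * a + e.+1) r =
    (cyc_coef p r (y ^+ e.+1 * fleckU p ^+ a))%:~R.
Proof.
move=> lte; rewrite /fleck_quotient fleck_sumE addnS addr0.
have p1_gt0 : (0 < p.-1)%N by case: (p.-1) lte.
have -> : (((p.-1 * a + e).+1%:Z - 1) %/ (p%:Z - 1))%Z = a%:Z.
  have -> : p%:Z - 1 = p.-1%:Z by lia.
  have -> : (p.-1 * a + e).+1%:Z - 1 = a%:Z * p.-1%:Z + e%:Z by lia.
  rewrite divzMDl; last by lia.
  by rewrite divz_small ?addr0 //; lia.
have /(pcong_cyc_coef p p_gt0 r) := sub1X_exp_fleckU p p_pr a e.
rewrite addnS dvd0z subr_eq0 => /eqP->.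
have -> : (- p%:R : {poly int}) ^+ a = ((- p%:Z) ^+ a)%:P.
  by rewrite polyC_exp polyCN -[p%:Z]natz polyC_natr.
rewrite mul_polyC cyc_coefZ // rmorphM rmorphXn rmorphN /= -exprnN mulKf //.
by rewrite expf_neq0 // oppr_eq0 pnatr_eq0 -lt0n.
Qed.

End Sums.

(** * Congruences modulo p and p^2 *)

(** First-order expansion; at n = 0 the truncated [n.-1] is harmless because of the factor
    [n%:R]. *)
Lemma exprD_sqr (R : comNzRingType) (x m z : R) (n : nat) :
  exists h, (x + m * z) ^+ n = x ^+ n + m * (n%:R * z * x ^+ n.-1) + m ^+ 2 * h.
Proof.
elim: n => [|[|n] [h IHn]]; first by exists 0; rewrite !expr0; ring.
  by exists 0; rewrite /= !expr1; ring.
exists (h * (x + m * z) + n.+1%:R * z * z * x ^+ n).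
rewrite exprS IHn /= [x ^+ n.+2]exprS [x ^+ n.+1]exprS [n.+2%:R]mulrS.
by move: (x ^+ n) n.+1%:R => xn c; ring.
Qed.

Section Fermat.

Variable p : nat.
Hypothesis p_pr : prime p.
Let p_gt0 := prime_gt0 p_pr.

Lemma dvdz_Fp (a : int) : (p%:Z %| a)%Z = (a%:~R == 0 :> 'F_p).
Proof. by rewrite (dvdz_pcharf (pchar_Fp p_pr)). Qed.

Lemma fermat_dvdz (a : int) : (p%:Z %| a ^+ p - a)%Z.
Proof.
rewrite dvdz_Fp rmorphB rmorphXn /= -[X in _ ^+ X](card_Fp p_pr).
by rewrite expf_card subrr.
Qed.

Lemma fermat_pred_dvdz (a : int) : ~~ (p%:Z %| a)%Z -> (p%:Z %| a ^+ p.-1 - 1)%Z.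
Proof.
move=> pa; have := fermat_dvdz a; rewrite !dvdz_Fp in pa *.
rewrite -[X in a ^+ X](prednK p_gt0) exprS -[X in _ - X]mulr1 -mulrBr rmorphM /=.
by rewrite mulf_eq0 (negPf pa).
Qed.

(** The linear term of the expansion carries p twice. Hence j^p modulo p^2 depends only on j modulo
    p: it is the Teichmueller representative. *)
Lemma dvdz_expX_prime (x z : int) :
  (p%:Z %| x - z)%Z -> ((p ^ 2)%N%:Z %| x ^+ p - z ^+ p)%Z.
Proof.
case/dvdzP=> q def_x.
have [h hE] := exprD_sqr _ z p%:Z q p.
have -> : x = z + p%:Z * q by rewrite mulrC -def_x subrKC.
rewrite hE; apply/dvdzP; exists (q * z ^+ p.-1 + h).
by rewrite PoszM -natz; ring.
Qed.

Lemma euler_sqr_dvdz (a : int) : ~~ (p%:Z %| a)%Z ->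
  ((p ^ 2)%N%:Z %| a ^+ (p * p.-1) - 1)%Z.
Proof.
move=> pa; rewrite mulnC exprM -(expr1n _ p); apply: dvdz_expX_prime.
exact: fermat_pred_dvdz.
Qed.

Lemma dvdz_expM_prime (x z : int) k : (p%:Z %| x - z)%Z ->
  ((p ^ 2)%N%:Z %| x ^+ (p * k) - z ^+ (p * k))%Z.
Proof. by move/dvdz_expX_prime=> xz; rewrite !exprM subrXX dvdz_mulr. Qed.

Lemma dvdz_sqr_cancel (c x : int) : ~~ (p%:Z %| c)%Z ->
  ((p ^ 2)%N%:Z %| c * x)%Z -> ((p ^ 2)%N%:Z %| x)%Z.
Proof.
by move=> pc; rewrite Gauss_dvdzr // coprimezE /= coprimeXl // prime_coprime.
Qed.

Lemma dvdz_cancel (c x : int) : ~~ (p%:Z %| c)%Z ->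
  (p%:Z %| c * x)%Z -> (p%:Z %| x)%Z.
Proof.
by move=> pc; rewrite Gauss_dvdzr // coprimezE /= prime_coprime.
Qed.

Lemma dvdz_fact i : (i < p)%N -> ~~ (p%:Z %| i`!%:Z)%Z.
Proof.
move=> ltip; rewrite -[(_ %| _)%Z]/(p %| i`!)%N.
elim: i ltip => [|i IHi] ltip; first by rewrite fact0 dvdn1 gtn_eqF // prime_gt1.
by rewrite factS Euclid_dvdM // negb_or gtnNdvd //= IHi // ltnW.
Qed.

(** X^f - 1 has at most f roots in F_p, fewer than the p - 1 units. *)
Lemma exists_unit_expr_neq1 f : (0 < f < p.-1)%N ->
  exists2 a : nat, coprime a p & ~~ (p%:Z %| a%:Z ^+ f - 1)%Z.
Proof.
move=> /andP[f_gt0 ltfp].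
have /existsP[x /andP[x0 xf]] : [exists x : 'F_p, (x != 0) && (x ^+ f != 1)].
  apply: contraTT ltfp => /existsPn all1; rewrite -leqNgt.
  have /max_poly_roots : 'X^f - 1 != 0 :> {poly 'F_p}.
    by rewrite -size_poly_gt0 -polyC1 size_XnsubC.
  move=> /(_ (enum (predC1 (0 : 'F_p)))); rewrite -polyC1 size_XnsubC // ltnS.
  rewrite -cardE cardC1 card_Fp //; apply; last exact: enum_uniq.
  apply/allP=> x; rewrite mem_enum inE /= => x0.
  have := all1 x; rewrite x0 negbK /= /root !hornerE => /eqP->.
  by rewrite subrr.
exists x; last by rewrite dvdz_Fp rmorphB rmorphXn /= -pmulrn natr_Zp subr_eq0.
rewrite coprime_sym prime_coprime //.
by rewrite -[(p %| x)%N]/(p%:Z %| (x : nat)%:Z)%Z dvdz_Fp -pmulrn natr_Zp.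
Qed.

End Fermat.

(** * The Gauss sum replacing T modulo p^2 *)

Section Teichmuller.

Variable p : nat.
Hypothesis p_pr : prime p.
Hypothesis p_gt2 : (2 < p)%N.
Let p_gt0 := prime_gt0 p_pr.

Local Notation y := (1 - 'X : {poly int}).
Local Notation D := ('X^p - 1 : {poly int}).
Local Notation T := (fleckT p).

Let c1 := cyc_coef p 1 T.

(* The Gauss sum of w^(-1) = w^(p-2), where w(j) = j^p modulo p^2, scaled so as to
   agree with [T] modulo p. *)
Definition teichT : {poly int} := \poly_(i < p) (c1 * i%:Z ^+ (p * p.-2)).
Local Notation W := teichT.

Lemma subr_residue (r : int) : (p%:Z %| r - (residue r p)%:Z)%Z.
Proof. by rewrite residueE // -eqz_mod_dvd modz_mod. Qed.

Lemma cyc_coef_teichT r :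
  ((p ^ 2)%N%:Z %| cyc_coef p r W - c1 * r ^+ (p * p.-2))%Z.
Proof.
rewrite cyc_coef_small ?size_poly // coef_poly residue_lt // -mulrBr.
apply: dvdz_mull; rewrite -opprB rpredN; apply: dvdz_expM_prime => //.
exact: subr_residue.
Qed.

(** Galois action on a Gauss sum: reindexing the sum of w(j)^(-1) X^(a j) by u = a j brings out
    w(a). *)
Lemma teichT_comp_Xn a : coprime a p ->
  pcong p (p ^ 2) ((a%:Z ^+ p) *: W) (W \Po 'X^a).
Proof.
move=> cop; have pa : ~~ (p%:Z %| a%:Z)%Z.
  by rewrite -[(p%:Z %| a%:Z)%Z]/(p %| a)%N -prime_coprime // coprime_sym.
apply: cyc_coef_pcong => // u.
have def_p1 : p.-2.+1 = p.-1 by lia.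
(* The power a^(p-2) inverts a modulo p. *)
pose s := a%:Z ^+ p.-2 * u.
have us : (u = a%:Z * s %[mod p%:Z])%Z.
  apply/esym/eqP; rewrite eqz_mod_dvd mulrA -exprS def_p1.
  by rewrite -{2}[u]mul1r -mulrBl dvdz_mulr // fermat_pred_dvdz.
rewrite !(cyc_coef_eqmod _ _ _ _ us) cyc_coef_comp_Xn // cyc_coefZ //.
have h1 := cyc_coef_teichT (a%:Z * s).
have h2 := cyc_coef_teichT s.
have h3 := euler_sqr_dvdz p p_pr a%:Z pa.
move: (cyc_coef p _ W) (cyc_coef p s W) h1 h2 => x1 x2 h1 h2.
have -> : a%:Z ^+ p * x1 - x2 = a%:Z ^+ p * (x1 - c1 * (a%:Z * s) ^+ (p * p.-2))
   - (x2 - c1 * s ^+ (p * p.-2))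
   + (a%:Z ^+ (p * p.-1) - 1) * (c1 * s ^+ (p * p.-2)).
  have -> : a%:Z ^+ (p * p.-1) = a%:Z ^+ p * a%:Z ^+ (p * p.-2).
    by rewrite -exprD -mulnS def_p1.
  have key (b1 b2 b3 : int) : b1 * x1 - x2 =
      b1 * (x1 - c1 * (b2 * b3)) - (x2 - c1 * b3) + (b1 * b2 - 1) * (c1 * b3) by ring.
  by rewrite exprMn; exact: key.
by rewrite rpredD ?dvdz_mulr // rpredB // dvdz_mull.
Qed.

Lemma cyc_coef_teichTX_comp a f s : coprime a p ->
  ((p ^ 2)%N%:Z %| a%:Z ^+ (p * f) * cyc_coef p (a%:Z * s) (W ^+ f)
                   - cyc_coef p s (W ^+ f))%Z.
Proof.
move=> cop; have := pcongX _ _ _ _ f (teichT_comp_Xn a cop).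
rewrite exprZn -exprM => /(pcong_cyc_coef p p_gt0 (a%:Z * s)).
have -> : (W \Po 'X^a) ^+ f = W ^+ f \Po 'X^a.
  by elim: f => [|f IHf]; rewrite ?expr0 ?comp_polyC // !exprS comp_polyM IHf.
by rewrite cyc_coefZ // cyc_coef_comp_Xn.
Qed.

(** The behaviour of W^f under X -> X^a forces this: for s prime to p, taking a = s modulo p reduces
    to the coefficient at 1, and w(s)^(-f) = w(s)^(p-1-f). *)
Lemma cyc_coef_teichTX f s : (0 < f < p.-1)%N ->
  ((p ^ 2)%N%:Z %| cyc_coef p s (W ^+ f)
                   - cyc_coef p 1 (W ^+ f) * s ^+ (p * (p.-1 - f)))%Z.
Proof.
move=> /andP[f_gt0 ltfp]; set k := cyc_coef p 1 _.
case: (boolP (p%:Z %| s)%Z) => ps.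
  rewrite (cyc_coef_eqmod _ s 0); last first.
    by apply/eqP; rewrite eqz_mod_dvd subr0.
  have ps0 : (p%:Z %| s - 0)%Z by rewrite subr0.
  have := dvdz_expM_prime p s 0 (p.-1 - f) ps0.
  have -> : 0 ^+ (p * (p.-1 - f)) = 0 :> int.
    by rewrite expr0n gtn_eqF // muln_gt0 p_gt0 subn_gt0.
  rewrite subr0 => ps2.
  apply: rpredB; last exact: dvdz_mull.
  (* At s = 0 the equivariance says that a^(p f) - 1 kills the coefficient modulo p^2; since a^(p f)
     = a^f modulo p, this choice of a makes the factor invertible. *)
  have [|a cop pa] := exists_unit_expr_neq1 p p_pr f; first by rewrite f_gt0.
  have := cyc_coef_teichTX_comp a f 0 cop.
  rewrite mulr0 -{2}[cyc_coef _ _ _]mul1r -mulrBl.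
  apply: dvdz_sqr_cancel => //; apply: contra pa => h.
  have h2 := fermat_dvdz p p_pr (a%:Z ^+ f); rewrite -exprM mulnC in h2.
  have -> : a%:Z ^+ f - 1 = (a%:Z ^+ (p * f) - 1) - (a%:Z ^+ (p * f) - a%:Z ^+ f).
    by ring.
  exact: rpredB.
set a := residue s p.
have pa : ~~ (p%:Z %| a%:Z)%Z.
  apply: contra ps => pa; rewrite -[s](subrK a%:Z) rpredD //.
  exact: subr_residue.
have cop : coprime a p by rewrite coprime_sym prime_coprime.
rewrite (cyc_coef_eqmod _ s (a%:Z * 1)); last first.
  by apply/eqP; rewrite mulr1 eqz_mod_dvd subr_residue.
have h1 := cyc_coef_teichTX_comp a f 1 cop.
have h2 := euler_sqr_dvdz p p_pr a%:Z pa.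
have h3 := dvdz_expM_prime p _ _ (p.-1 - f) (subr_residue s).
rewrite -/a -/k in h1 h3 *; move: (cyc_coef p _ _) h1 => x h1.
have -> : x - k * s ^+ (p * (p.-1 - f)) =
   a%:Z ^+ (p * (p.-1 - f)) * (a%:Z ^+ (p * f) * x - k)
   - (a%:Z ^+ (p * p.-1) - 1) * x
   - k * (s ^+ (p * (p.-1 - f)) - a%:Z ^+ (p * (p.-1 - f))).
  have -> : a%:Z ^+ (p * p.-1) = a%:Z ^+ (p * (p.-1 - f)) * a%:Z ^+ (p * f).
    by rewrite -exprD -mulnDr subnK // ltnW.
  have key (b1 b2 b3 : int) :
      x - k * b3 = b1 * (b2 * x - k) - (b1 * b2 - 1) * x - k * (b3 - b1) by ring.
  exact: key.
apply: rpredB; last exact: dvdz_mull.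
by apply: rpredB; [exact: dvdz_mull | exact: dvdz_mulr].
Qed.

(** Modulo p both coefficient sequences are proportional to r^(p-2), and the scaling [c1] makes them
    agree at r = 1. *)
Lemma pcong_teichT : pcong p p T W.
Proof.
have T1 r : (p%:Z %| (p.-2)`!%:Z * cyc_coef p r T - r ^+ p.-2)%Z.
  have := cyc_coef_fleckTX p p_pr p.-2 r; rewrite (_ : p.-1 - p.-2 = 1)%N; last by lia.
  by apply; lia.
apply: cyc_coef_pcong => // r.
apply: (dvdz_cancel p p_pr (p.-2)`!%:Z); first by apply: dvdz_fact => //; lia.
have h1 := T1 r; have h2 := T1 1; rewrite expr1n -/c1 in h2.
have h3 : (p%:Z %| cyc_coef p r W - c1 * r ^+ (p * p.-2))%Z.
  by apply: dvdz_trans (cyc_coef_teichT r); rewrite PoszM dvdz_mulr.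
have h4 := fermat_dvdz p p_pr (r ^+ p.-2); rewrite -exprM mulnC in h4.
move: (cyc_coef p r T) (cyc_coef p r W) (r ^+ (p * p.-2)) h1 h3 h4 => t w x h1 h3 h4.
have -> : (p.-2)`!%:Z * (t - w) = ((p.-2)`!%:Z * t - r ^+ p.-2)
    - (p.-2)`!%:Z * (w - c1 * x) - ((p.-2)`!%:Z * c1 - 1) * x - (x - r ^+ p.-2).
  by move: ((p.-2)`!) (r ^+ p.-2) => f b; ring.
apply: rpredB => //; apply: rpredB; last exact: dvdz_mulr.
by apply: rpredB => //; apply: dvdz_mull.
Qed.

(** Comparison with T^f. Knowing this constant modulo p suffices, as it will multiply a sum
    divisible by p. *)
Lemma fact_cyc_coef_teichTX f : (0 < f < p.-1)%N ->
  (p%:Z %| (p.-1 - f)`!%:Z * cyc_coef p 1 (W ^+ f) - 1)%Z.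
Proof.
move=> /andP[f_gt0 ltfp].
have h1 := pcong_cyc_coef p p_gt0 1 p _ _ (pcongX _ _ _ _ f pcong_teichT).
have lt1 : (p.-1 - f < p.-1)%N by lia.
have h2 := cyc_coef_fleckTX p p_pr _ 1 lt1.
rewrite expr1n subKn 1?ltnW // in h2.
move: (cyc_coef p 1 (T ^+ f)) (cyc_coef p 1 (W ^+ f)) h1 h2 => t w h1 h2.
have -> : (p.-1 - f)`!%:Z * w - 1 =
  ((p.-1 - f)`!%:Z * t - 1) - (p.-1 - f)`!%:Z * (t - w) by ring.
by apply: rpredB => //; apply: dvdz_mull.
Qed.

(* [X -> X^2] multiplies [W] by [2^p], which is not 1 modulo p, and preserves the
   value at 1. *)
Lemma teichT_horner1 : ((p ^ 2)%N%:Z %| W.[1])%Z.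
Proof.
have cop : coprime 2 p.
  by rewrite coprime2n; case/even_prime: (p_pr) => // p2; move: p_gt2; rewrite p2.
have [A [B]] := teichT_comp_Xn 2 cop.
move/(congr1 (horner^~ 1)); rewrite /= hornerZ !hornerD horner_comp !hornerM.
rewrite hornerD hornerN !hornerXn hornerC !expr1n subrr mul0r addr0.
rewrite -polyC_natr hornerC hornerX mulr1 => W2.
apply: (dvdz_sqr_cancel p p_pr (2 ^+ p - 1)).
  have /rpredB h := fermat_dvdz p p_pr 2; apply/negP => /h.
  have -> : 2 ^+ p - 2 - (2 ^+ p - 1) = - 1 :> int by ring.
  by rewrite dvdzE /= dvdn1 gtn_eqF // ltnW.
by rewrite mulrBl mul1r W2 [X in X - _]addrC addrK natz dvdz_mulr.
Qed.

(** Both T and W vanish at 1 modulo p^2, so W - T is p times a multiple of y, modulo p^2 and X^p -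
    1. The first-order error then contains p y^(n+f), and y^p supplies the second factor p. *)
Lemma sub1XM_teichTX n f : (0 < f)%N -> (p <= n + f)%N ->
  pcong p (p ^ 2) (y ^+ n * T ^+ f) (y ^+ n * W ^+ f).
Proof.
move=> f_gt0 le_p_nf.
have [A [B TE]] := pcong_teichT.
have [A' AE] : exists A', A = A.[1]%:P + y * A'.
  have /factor_theorem[q Aq] : root (A - A.[1]%:P) 1 by rewrite /root !hornerE subrr.
  by exists (- q); rewrite -[LHS](subrK A.[1]%:P) Aq polyC1; ring.
have [c cE] : exists c : int, A.[1] = p%:Z * c.
  have := congr1 (horner^~ 1) TE.
  rewrite /= /fleckT !(hornerD, hornerM, hornerN, hornerXn) hornerX hornerC.
  rewrite expr1n subrr !mul0r addr0 -polyC_natr hornerC natz => /esym/eqP.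
  rewrite addrC addr_eq0 => /eqP pA.
  case/dvdzP: teichT_horner1 => d dE; exists (- d).
  apply/(mulfI (_ : p%:Z != 0)); first by rewrite -lt0n.
  by rewrite pA dE PoszM; ring.
have WT : pcong p (p ^ 2) W (T + p%:R * (- (y * A'))).
  exists (- c%:P), (- B); rewrite TE AE cE polyCM -[p%:Z]natz polyC_natr natrX.
  by ring.
apply: pcong_sym; apply: pcong_trans (pcongMl _ _ _ _ _ (pcongX _ _ _ _ f WT)) _.
have [h ->] := exprD_sqr _ T p%:R (- (y * A')) f.
(* The factor y of the error joins y^n and T^(f-1) to give y^(n+f) U^(f-1), which contains y^p. *)
have yT : y ^+ n.+1 * T ^+ f.-1 = y ^+ p * (y ^+ (n + f - p) * fleckU p ^+ f.-1).
  by rewrite exprMn !mulrA -!exprD; congr (_ ^+ _ * _); lia.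
exists (y ^+ n * h + f%:R * A' * T * (y ^+ (n + f - p) * fleckU p ^+ f.-1)).
exists (p%:R * f%:R * A' * (y ^+ (n + f - p) * fleckU p ^+ f.-1)).
have -> : y ^+ n * (T ^+ f + p%:R * (f%:R * - (y * A') * T ^+ f.-1) + p%:R ^+ 2 * h) =
  y ^+ n * T ^+ f - p%:R * f%:R * A' * (y ^+ n.+1 * T ^+ f.-1)
  + p%:R ^+ 2 * (y ^+ n * h).
  by rewrite [y ^+ n.+1]exprS; ring.
rewrite yT (sub1X_exp_prime p p_pr).
have key (V Y : {poly int}) :
  Y - p%:R * f%:R * A' * ((- D - p%:R * T) * V) + p%:R ^+ 2 * (y ^+ n * h)
  = Y + (p ^ 2)%:R * (y ^+ n * h + f%:R * A' * T * V) + D * (p%:R * f%:R * A' * V).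
  by ring.
exact: key.
Qed.

End Teichmuller.

(** * Coefficient formulas for the three cases *)

(** Splitting off one factor r - k and absorbing k into the binomial coefficient lowers the degree:
    an n-th difference kills polynomials of degree below n. *)
Lemma sum_bin_sign_expr (n i : nat) (r : int) : (i < n)%N ->
  \sum_(0 <= k < n.+1) 'C(n, k)%:Z * (-1) ^+ k * (r - k%:Z) ^+ i = 0.
Proof.
elim: i n r => [|i IHi] [//|n] r ltin.
  have := congr1 (horner^~ 1) (sub1X_expE n.+1).
  rewrite /= horner_exp hornerD hornerN hornerX hornerC subrr expr0n /= => /esym.
  rewrite horner_sum big_mkord; apply: etrans; apply: eq_bigr => k _.
  by rewrite hornerZ hornerXn expr1n !mulr1 mulrC.
have split k : 'C(n.+1, k)%:Z * (-1) ^+ k * (r - k%:Z) ^+ i.+1 =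
    r * ('C(n.+1, k)%:Z * (-1) ^+ k * (r - k%:Z) ^+ i)
    - (k * 'C(n.+1, k))%N%:Z * (-1) ^+ k * (r - k%:Z) ^+ i.
  by rewrite PoszM [_ ^+ i.+1]exprS; ring.
rewrite (eq_bigr _ (fun k _ => split k)) sumrB -mulr_sumr IHi 1?ltnW // mulr0 sub0r.
rewrite big_nat_recl // mul0n !mul0r add0r.
under eq_bigr => k _.
  rewrite -mul_bin_diag PoszM exprS (_ : r - k.+1%:Z = r - 1 - k%:Z); last by lia.
  rewrite mulN1r mulrN mulNr -2!mulrA.
  over.
by rewrite sumrN -mulr_sumr /= (eq_bigr _ (fun k _ => mulrA _ _ _)) IHi // mulr0 !oppr0.
Qed.

Section Cases.

Variable p : nat.
Hypothesis p_pr : prime p.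
Let p_gt0 := prime_gt0 p_pr.

Local Notation y := (1 - 'X : {poly int}).
Local Notation D := ('X^p - 1 : {poly int}).
Local Notation U := (fleckU p).
Local Notation T := (fleckT p).

Lemma cyc_coef_sub1X_fleckTX n0 n1 r : (n1 < p.-1)%N ->
  (p%:Z %| n1`!%:Z * cyc_coef p r (y ^+ n0 * T ^+ (p.-1 - n1)) - (-1) ^+ n1 *
    \sum_(0 <= k < n0.+1) 'C(n0, k)%:Z * (-1) ^+ k * (k%:Z - r) ^+ n1)%Z.
Proof.
move=> lt1; rewrite cyc_coef_sub1XM // !mulr_sumr -sumrB rpred_sum // => k _.
have := cyc_coef_fleckTX p p_pr n1 (r - k%:Z) lt1.
move: (cyc_coef p _ _) => x; rewrite -[r - k%:Z]opprB [(- (k%:Z - r)) ^+ n1]exprNn => h.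
by rewrite mulrCA [X in _ - X]mulrCA -mulrBr; apply: dvdz_mull.
Qed.

Lemma cyc_coef_fleck_small n0 r : (n0 < p)%N ->
  cyc_coef p r (y ^+ n0) = (-1) ^+ residue r p * 'C(n0, residue r p)%:Z.
Proof.
move=> lt0; rewrite sub1X_expE cyc_coef_small //; last first.
  rewrite -(poly_def n0.+1 (fun i => (-1) ^+ i * 'C(n0, i)%:Z)).
  exact: leq_trans (size_poly _ _) lt0.
rewrite -(poly_def n0.+1 (fun i => (-1) ^+ i * 'C(n0, i)%:Z)) coef_poly ltnS.
by case: leqP => // ltr; rewrite bin_small // mulr0.
Qed.

(** The case n0 > n1 > 0. Division by -p is avoided by keeping the factor p and working modulo p^2;
    the sum is p times the one with Fermat quotients, up to sign. *)
Lemma cyc_coef_fleck_quot a n0 n1 r : (0 < n1 < n0)%N -> (n0 < p)%N ->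
  (a + n1 = 0 %[mod p])%N ->
  ((p ^ 2)%N%:Z %| (n1.-1)`!%:Z * (p%:Z * cyc_coef p r (y ^+ (n0 - n1) * U ^+ a)) +
    \sum_(0 <= k < n0.+1) 'C(n0, k)%:Z * (-1) ^+ k *
      ((r - k%:Z) ^+ (n1 + p.-1) - (r - k%:Z) ^+ n1))%Z.
Proof.
move=> /andP[n1_gt0 lt10] lt0p a_n1.
have p_gt2 : (2 < p)%N by lia.
have n1p : (n1 + p.-1 = p + n1.-1)%N by lia.
have [f def_f] : exists f, (f + n1 = p.-1)%N by exists (p.-1 - n1)%N; lia.
have f_lt : (0 < f < p.-1)%N by lia.
have f_gt0 : (0 < f)%N by case/andP: f_lt.
have def_n1 : (p.-1 - f = n1)%N by lia.
have [e def_e] : exists e, (n0 - n1 = e.+1)%N by exists (n0 - n1).-1; lia.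
have def_ep : (p + e = n0 + f)%N by lia.
have f1n1 : (f.+1 + n1 = p)%N by lia.
rewrite def_e.
set S := \sum_(0 <= k < n0.+1) _; set G := cyc_coef p r _.
set H := cyc_coef p r (y ^+ n0 * T ^+ f).
(* With f = p - 1 - n1, y^n0 T^f contains y^p and becomes -p y^(n0-n1) U^(f+1), where a = f + 1
   modulo p. *)
have GH : ((p ^ 2)%N%:Z %| p%:Z * G - - H)%Z.
  rewrite -cyc_coefN // -cyc_coefZ //; apply: pcong_cyc_coef => //.
  have /(fleckUX_eqmod p p_pr)[A [B ->]] : (a = f.+1 %[mod p])%N.
    apply/eqP; rewrite -(eqn_modDr n1); by rewrite a_n1 f1n1 modnn mod0n.
  have -> : y ^+ n0 * T ^+ f = y ^+ p * (y ^+ e * U ^+ f).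
    by rewrite exprMn !mulrA -!exprD def_ep.
  rewrite (sub1X_exp_prime p p_pr) -[p%:Z]natz scaler_nat -mulr_natl [y ^+ e.+1]exprS.
  rewrite [U ^+ f.+1]exprS /fleckT /=.
  exists (y * y ^+ e * A).
  exists (p%:R * (y * y ^+ e * B) - y ^+ e * U ^+ f).
  by ring.
have HW : ((p ^ 2)%N%:Z %| H - cyc_coef p r (y ^+ n0 * teichT p ^+ f))%Z.
  by apply: pcong_cyc_coef => //; apply: sub1XM_teichTX => //; rewrite -def_ep leq_addr.
set H' := cyc_coef p r _ in HW.
pose k := cyc_coef p 1 (teichT p ^+ f).
have HS : ((p ^ 2)%N%:Z %| H' - k * n1%:Z * S)%Z.
  (* The added sum is zero because n1 < n0; it absorbs the polynomial part of w(r - j)^n1. *)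
  have -> : k * n1%:Z * S = k * (n1%:Z * S
     + \sum_(0 <= j < n0.+1) 'C(n0, j)%:Z * (-1) ^+ j * (r - j%:Z) ^+ n1).
    by rewrite sum_bin_sign_expr // addr0 mulrA.
  rewrite /H' /S cyc_coef_sub1XM // !mulr_sumr -big_split /= mulr_sumr -sumrB.
  apply: rpred_sum => j _.
  have h1 := cyc_coef_teichTX p p_pr p_gt2 f (r - j%:Z) f_lt.
  rewrite def_n1 -/k in h1; move: (cyc_coef p _ _) h1 => x; move: (r - j%:Z) => s h1.
  (* Expand (s + p q)^n1 to first order, where s^p = s + p q. *)
  have h2 : ((p ^ 2)%N%:Z %| s ^+ (p * n1)
      - (n1%:Z * (s ^+ (n1 + p.-1) - s ^+ n1) + s ^+ n1))%Z.
    have /dvdzP[q qE] := fermat_dvdz p p_pr s.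
    have [h hE] := exprD_sqr _ s p%:Z q n1.
    have sp : s ^+ p = s + p%:Z * q by rewrite [p%:Z * q]mulrC -qE; ring.
    rewrite exprM sp hE.
    have -> : s ^+ (n1 + p.-1) = s ^+ p * s ^+ n1.-1 by rewrite n1p exprD.
    have -> : s ^+ n1 = s * s ^+ n1.-1 by rewrite -exprS prednK.
    rewrite sp; apply/dvdzP; exists h; rewrite PoszM natz.
    by ring.
  have -> : 'C(n0, j)%:Z * (-1) ^+ j * x - k * (n1%:Z * ('C(n0, j)%:Z * (-1) ^+ j *
        (s ^+ (n1 + p.-1) - s ^+ n1)) + 'C(n0, j)%:Z * (-1) ^+ j * s ^+ n1) =
     'C(n0, j)%:Z * (-1) ^+ j * ((x - k * s ^+ (p * n1)) + k * (s ^+ (p * n1)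
      - (n1%:Z * (s ^+ (n1 + p.-1) - s ^+ n1) + s ^+ n1))) by ring.
  by apply: dvdz_mull; apply: rpredD => //; apply: dvdz_mull.
(* Needed because the product of n1! and k is known to be 1 only modulo p. *)
have pS : (p%:Z %| S)%Z.
  apply: rpred_sum => j _; apply: dvdz_mull.
  have -> : (r - j%:Z) ^+ (n1 + p.-1) - (r - j%:Z) ^+ n1 =
     (r - j%:Z) ^+ n1.-1 * ((r - j%:Z) ^+ p - (r - j%:Z)).
    by rewrite mulrBr -exprD -exprSr prednK // [(n1.-1 + p)%N]addnC -n1p.
  by apply: dvdz_mull; apply: fermat_dvdz.
have h3 := fact_cyc_coef_teichTX p p_pr p_gt2 f f_lt.
rewrite def_n1 -/k -(prednK n1_gt0) factS in h3.
have h4 : ((p ^ 2)%N%:Z %| ((n1.-1.+1 * (n1.-1)`!)%N%:Z * k - 1) * S)%Z.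
  by rewrite [(p ^ 2)%N%:Z]PoszM; apply: dvdz_mul.
have -> : (n1.-1)`!%:Z * (p%:Z * G) + S = (n1.-1)`!%:Z * ((p%:Z * G - - H)
   - (H - H') - (H' - k * n1%:Z * S)) - ((n1.-1.+1 * (n1.-1)`!)%N%:Z * k - 1) * S.
  by rewrite PoszM prednK //; ring.
by apply: rpredB => //; apply: dvdz_mull; apply: rpredB => //; apply: rpredB.
Qed.

End Cases.

(** * The value n = 0, the indices, and the assembly *)

(** The floor is -1, so the Fleck sum acquires a factor -p and only the bracket survives. *)
Lemma fleck_quotient0 (p : nat) (r : int) : prime p ->
  rat_congr p (fleck_quotient p 0 r) 1.
Proof.
move=> p_pr; have p_gt1 := prime_gt1 p_pr.
exists (- (fleck_sum p 0 r)%:~R).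
  by rewrite /padic_integral -rmorphN denq_int dvdz1 /= gtn_eqF.
rewrite /fleck_quotient (_ : ((0%:Z - 1) %/ (p%:Z - 1))%Z = -1).
  by rewrite opprK expr1z addrK mulNr mulrN.
have -> : 0%:Z - 1 = -1 * (p%:Z - 1) + (p%:Z - 2) by ring.
by rewrite divzMDl ?divz_small ?addr0 //; lia.
Qed.

(** Euclidean division of n - 1 by p - 1; [e.+1] is the exponent called e in the outline. The
    alternatives record whether n0 - (e+1) is already a residue modulo p - 1 or needs p - 1 added;
    they match n1 < n0 and n0 <= n1. *)
Lemma fleck_index (p n : nat) : prime p -> (0 < n)%N ->
  let n0 := residue n%:Z p in let n1 := residue (n0%:Z - n%:Z) p.-1 in
  exists a e, [/\ n = (p.-1 * a + e.+1)%N, (e < p.-1)%N,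
    (a + n0 = e.+1 %[mod p])%N
    & n0 = (n1 + e.+1)%N \/ (n0 < e.+1)%N /\ (n0 + p.-1 = n1 + e.+1)%N].
Proof.
move=> p_pr n_gt0 n0 n1; have p_gt1 := prime_gt1 p_pr.
have p1_gt0 : (0 < p.-1)%N by rewrite -ltnS prednK // ltnW.
have n0E : n0 = (n %% p)%N by rewrite /n0 /residue modz_nat.
have lt0 : (n0 < p)%N by rewrite n0E ltn_pmod // ltnW.
pose a := (n.-1 %/ p.-1)%N; pose e := (n.-1 %% p.-1)%N.
have lte : (e < p.-1)%N by rewrite ltn_pmod.
have nE : n = (p.-1 * a + e.+1)%N.
  by rewrite addnS mulnC -divn_eq prednK.
exists a, e; split=> //.
  rewrite n0E modnDmr {1}nE addnA -mulSn prednK 1?ltnW //.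
  by rewrite mulnC modnMDl.
have n1E : n1%:Z = ((n0%:Z - n%:Z) %% p.-1%:Z)%Z by rewrite residueE.
case: (ltnP e n0) => en0; [left | right; split=> //].
  move: n1E; have -> : n0%:Z - n%:Z = - a%:Z * p.-1%:Z + (n0 - e.+1)%N%:Z.
    by rewrite {1}nE PoszD PoszM -subzn //; ring.
  by rewrite modzMDl modz_nat modn_small => [[->]|]; lia.
move: n1E; have -> : n0%:Z - n%:Z =
    (- a%:Z - 1) * p.-1%:Z + (n0 + p.-1 - e.+1)%N%:Z.
  by rewrite {1}nE PoszD PoszM -subzn ?PoszD; [ring | lia].
by rewrite modzMDl modz_nat modn_small => [[->]|]; lia.
Qed.

Theorem theorem1p1 (p : nat) (hp : prime p) (n : nat) (r : int) :
  let n0 := residue n%:Z p in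
  let n1 := residue (n0%:Z - n%:Z) p.-1 in
  [/\ n1 = residue (- (n %/ p)%N%:Z) p.-1,
      (n0 <= n1)%N ->
        rat_congr p (fleck_quotient p n r)
          ((-1) ^+ n1 / n1`!%:R *
           \sum_(0 <= k < n0.+1)
             'C(n0, k)%:R * (-1) ^+ k * ((k%:Z - r)%:~R) ^+ n1),
      (n1 < n0)%N -> n1 = 0%N ->
        rat_congr p (fleck_quotient p n r)
          ((-1) ^+ residue r p * 'C(n0, residue r p)%:R)
    & (n1 < n0)%N -> (0 < n1)%N ->
        rat_congr p (fleck_quotient p n r)
          ((-1) ^+ n1.-1 / (n1.-1)`!%:R *
           \sum_(0 <= k < n0.+1)
             'C(n0, k)%:R * (-1) ^+ k * ((k%:Z - r)%:~R) ^+ n1 *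
             fermat_quotient p (k%:Z - r))].
Proof.
move=> n0 n1; have p_gt1 := prime_gt1 hp; have p_gt0 := prime_gt0 hp.
have p1_gt0 : (0 < p.-1)%N by rewrite -ltnS prednK.
have n0E : n0 = (n %% p)%N by rewrite /n0 /residue modz_nat.
have lt0 : (n0 < p)%N by rewrite n0E ltn_pmod.
have lt1 : (n1 < p.-1)%N by apply: residue_lt.
have n1E : n1 = residue (- (n %/ p)%N%:Z) p.-1.
  rewrite /n1 /residue; congr (absz _).
  (* From n = floor(n/p) p + n0 and p = (p - 1) + 1. *)
  have -> : n0%:Z - n%:Z = - (n %/ p)%N%:Z * p.-1%:Z - (n %/ p)%N%:Z.
    have -> : n%:Z = (n %/ p)%N%:Z * p%:Z + n0%:Z by rewrite n0E {1}(divn_eq n p).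
    by rewrite -{2}(prednK p_gt0); lia.
  by rewrite modzMDl.
(* The decomposition requires n > 0; at n = 0 both n0 and n1 vanish. *)
case: (posnP n) => [n_0 | n_gt0].
  have n0_0 : n0 = 0%N by rewrite n0E n_0 mod0n.
  have n1_0 : n1 = 0%N by rewrite /n1 n0_0 n_0 subrr /residue mod0z.
  rewrite n0_0 n1_0; split=> // [|_]; first by rewrite -n1_0.
  by rewrite n_0 big_nat1 !expr0 bin0 fact0 invr1 !mulr1; apply: fleck_quotient0.
have [a [e [nE lte a_n0 n01]]] := fleck_index p n hp n_gt0.
rewrite -/n0 -/n1 in a_n0 n01.
split=> // [le01 | lt10 n1_0 | lt10 n1_gt0].
- case: n01 => [|[_ n01]]; first by lia.
  have eE : (e.+1 = n0 + (p.-1 - n1))%N by lia.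
  (* Hence y^(e+1) U^a becomes y^n0 T^(p-1-n1) modulo p. *)
  have /(fleckUX_eqmod p hp) Ua : (a = p.-1 - n1 %[mod p])%N.
    by apply/eqP; rewrite -(eqn_modDr n0) a_n0 eE addnC.
  rewrite {1}nE fleck_quotientE //.
  set w := (-1) ^+ n1 *
    \sum_(0 <= k < n0.+1) 'C(n0, k)%:Z * (-1) ^+ k * (k%:Z - r) ^+ n1.
  have -> : (-1) ^+ n1 / n1`!%:R * (\sum_(0 <= k < n0.+1)
        'C(n0, k)%:R * (-1) ^+ k * ((k%:Z - r)%:~R) ^+ n1) =
      w%:~R / (n1`!%:Z)%:~R :> rat.
    rewrite mulrAC /w rmorphM rmorphXn rmorph_sum rmorphN1 /=; congr (_ * _ / _).
    by apply: eq_bigr => k _; rewrite !rmorphM !rmorphXn rmorphN1.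
  apply: rat_congr_frac => //; first by apply: dvdz_fact => //; lia.
  have h1 := pcong_cyc_coef p p_gt0 r p _ _ (pcongMl _ _ ((1 - 'X) ^+ e.+1) _ _ Ua).
  rewrite {2}eE exprD -mulrA -exprMn in h1.
  have h2 := cyc_coef_sub1X_fleckTX p hp n0 n1 r lt1.
  rewrite -/w in h2.
  move: (cyc_coef p r _) (cyc_coef p r _) h1 h2 => t x h1 h2.
  have -> : n1`!%:Z * x - w = n1`!%:Z * (x - t) + (n1`!%:Z * t - w) by ring.
  by apply: rpredD => //; apply: dvdz_mull.
- case: n01 => [n01|]; last by lia.
  rewrite n1_0 add0n in n01.
  (* Now e + 1 = n0 and U^a = 1 modulo p, so only y^n0 is left. *)
  have /(fleckUX_eqmod p hp) Ua : (a = 0 %[mod p])%N.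
    by apply/eqP; rewrite -(eqn_modDr n0) a_n0 n01.
  rewrite {1}nE fleck_quotientE //.
  have -> : (-1) ^+ residue r p * 'C(n0, residue r p)%:R =
      ((-1) ^+ residue r p * 'C(n0, residue r p)%:Z)%:~R / (1 : int)%:~R :> rat.
    by rewrite divr1 rmorphM rmorphXn rmorphN1.
  apply: rat_congr_frac => //; first by rewrite dvdz1 /= gtn_eqF.
  have h1 := pcong_cyc_coef p p_gt0 r p _ _ (pcongMl _ _ ((1 - 'X) ^+ e.+1) _ _ Ua).
  by rewrite mul1r -cyc_coef_fleck_small // n01; rewrite mulr1 in h1.
- case: n01 => [n01|]; last by lia.
  have eE : (e.+1 = n0 - n1)%N by lia.
  have p_gt2 : (2 < p)%N by lia.
  have lt1p : (n1.-1 < p)%N by lia.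
  have p_odd : odd p by case: (even_prime hp) => // p2; rewrite p2 in p_gt2.
  have a_n1 : (a + n1 = 0 %[mod p])%N.
    apply/eqP; rewrite -(eqn_modDr e.+1) -addnA -n01 a_n0 add0n; exact: eqxx.
  rewrite {1}nE fleck_quotientE // eE.
  have := cyc_coef_fleck_quot p hp a n0 n1 r; rewrite n1_gt0 lt10 => /(_ isT lt0 a_n1).
  set x := cyc_coef p r _; set S := \sum_(0 <= k < n0.+1) _ => xS.
  (* Passes from r - k to k - r; p - 1 is even, so only the sign (-1)^n1 appears. *)
  have sgn (u : int) : u ^+ (n1 + p.-1) - u ^+ n1 =
      (-1) ^+ n1 * ((- u) ^+ n1 * ((- u) ^+ p.-1 - 1)).
    have -> : (- u) ^+ p.-1 = u ^+ p.-1.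
      by rewrite exprNn -signr_odd -subn1 oddB // p_odd expr0 mul1r.
    by rewrite [(- u) ^+ n1]exprNn -[X in _ = _ * X]mulrA signrMK exprD mulrBr mulr1.
  (* Integrality holds even for terms with p dividing r - k, since n1 > 0 provides the factor needed
     to form s^p - s. *)
  have [q Sq] : exists q, S = q * p%:Z.
    apply/dvdzP; apply: rpred_sum => k _; apply: dvdz_mull.
    rewrite -(prednK n1_gt0) addSnnS prednK // exprD exprSr -mulrBr.
    by apply: dvdz_mull; apply: fermat_dvdz.
  have -> : (-1) ^+ n1.-1 / (n1.-1)`!%:R * (\sum_(0 <= k < n0.+1)
             'C(n0, k)%:R * (-1) ^+ k * ((k%:Z - r)%:~R) ^+ n1 *
             fermat_quotient p (k%:Z - r)) = (- q)%:~R / ((n1.-1)`!%:Z)%:~R :> rat.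
    have p0 : p%:R != 0 :> rat by rewrite pnatr_eq0 -lt0n.
    rewrite mulrAC; congr (_ / _); apply/(mulIf p0).
    have -> : (- q)%:~R * p%:R = - S%:~R :> rat by rewrite Sq !rmorphM rmorphN mulNr.
    rewrite /S rmorph_sum -mulrA mulr_suml mulr_sumr -sumrN.
    apply: eq_bigr => k _.
    rewrite sgn !opprB /fermat_quotient -[_ * p%:R]mulrA divfK //.
    move: (k%:Z - r) => j; rewrite -{3}(prednK n1_gt0) exprS.
    rewrite !rmorphM rmorphB !rmorphXn rmorph1 rmorphN1 /=.
    by ring.
  apply: rat_congr_frac => //; first exact: dvdz_fact.
  have p0 : p%:Z != 0 by rewrite -lt0n.
  (* Restores the factor p, turning the goal into the divisibility by p^2 already obtained. *)
  rewrite -(dvdz_mul2l (p := p%:Z)) // opprK.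
  move: xS; rewrite Sq; apply: etrans; congr (_ \in dvdz _); ring.
Qed.
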